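(* If $\mathbb{B}$ is a non-atomic $\sigma$-finite c.c. Boolean algebra, then $\langle{}^\omega\omega,\le^*,{}^\omega\omega\rangle\le_{\mathrm T}\mathbf{Part}^*(\mathbb{B})$.
   Context: A relational system is a triple $\mathbf{A}=\langle A_-,A,A_+\rangle$ with $A\subseteq A_-\times A_+$. A generalized Galois–Tukey connection from $\mathbf{A}$ to $\mathbf{B}=\langle B_-,B,B_+\rangle$ is a pair of functions $\varphi_-\colon A_-\to B_-$, $\varphi_+\colon B_+\to A_+$ such that for all $a\in A_-$, $b\in B_+$: $\langle\varphi_-(a),b\rangle\in B$ implies $\langle a,\varphi_+(b)\rangle\in A$. We write $\mathbf{A}\le_{\mathrm T}\mathbf{B}$ if such a connection exists. For $f,g\in{}^\omega\omega$, $f\le^*g$ means $f(n)\le g(n)$ for all but finitely many $n$. A Boolean algebra $\mathbb{B}$ is $\sigma$-finite c.c. if $\mathbb{B}^+=\mathbb{B}\setminus\{\mathbb 0\}=\bigcup_{n<\omega}S_n$ where every antichain contained in $S_n$ is finite. Such algebras are c.c.c. For a c.c.c. Boolean algebra $\mathbb{B}$, $\mathrm{Part}(\mathbb{B})$ is the set of maximal antichains (maximal sets of pairwise disjoint elements of $\mathbb{B}^+$). For $A,B\in\mathrm{Part}(\mathbb{B})$, $A\le B$ ($B$ refines $A$) if every $b\in B$ lies below some $a\in A$; for finite $F\subseteq A$, $A^F=(A\setminus F)\cup\{\bigvee F\}$; and $A\le^*B$ ($B$ almost refines $A$) if $A^F\le B$ for some finite $F\subseteq A$. $\mathbf{Part}^*(\mathbb{B})=\langle\mathrm{Part}(\mathbb{B}),\le^*,\mathrm{Part}(\mathbb{B})\rangle$.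 *)

(* Defs.v *)
From mathcomp Require Import all_boot all_order finmap.
From mathcomp Require Import boolp classical_sets cardinality.

Set Implicit Arguments.
Unset Strict Implicit.
Unset Printing Implicit Defensive.

Local Open Scope order_scope.
Local Open Scope classical_set_scope.

Record relsys := RelSys {
  chal : Type;
  resp : Type;
  srel : chal -> resp -> Prop
}.

Definition is_GT_connection (A B : relsys)
    (phim : chal A -> chal B) (phip : resp B -> resp A) : Prop :=
  forall (a : chal A) (b : resp B), srel (phim a) b -> srel a (phip b).

Definition Tukey_le (A B : relsys) : Prop :=
  exists (phim : chal A -> chal B) (phip : resp B -> resp A),
    is_GT_connection phim phip.

Definition le_star (f g : nat -> nat) : Prop :=
  finite_set [set n | ~ (f n <= g n)%N].

Definition omega_star : relsys := RelSys le_star.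

(* Boolean algebras are complemented distributive lattices with top and
   bottom; the one-element algebra is not excluded by the structure. *)
Section BooleanAlgebra.
Context {d : Order.disp_t} {B : ctbDistrLatticeType d}.
Implicit Types (A P : set B) (F : {fset B}).

(* Antichains in the forcing sense: nonzero, pairwise disjoint elements. *)
Definition antichain A : Prop :=
  (forall a, A a -> a != \bot) /\
  (forall a b, A a -> A b -> a != b -> Order.meet a b = \bot).

Definition maximal_antichain A : Prop :=
  antichain A /\ (forall A', antichain A' -> A `<=` A' -> A' = A).

Definition refines A P : Prop :=
  forall p, P p -> exists2 a, A a & p <= a.

(* The set A^F. For F empty it is A together with \bot, which makes no
   difference to which sets of nonzero elements refine it. *)
Definition collapse A F : set B :=
  (A `\` [set` F]) `|` [set \join_(x <- F) x].

Definition almost_refines A P : Prop :=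
  exists2 F : {fset B}, [set` F] `<=` A & refines (collapse A F) P.

End BooleanAlgebra.

Section BooleanAlgebraProperties.
Context {d : Order.disp_t} (B : ctbDistrLatticeType d).

Definition atom (a : B) : Prop :=
  a != \bot /\ (forall x : B, x <= a -> x = \bot \/ x = a).

Definition atomic : Prop :=
  forall x : B, x != \bot -> exists2 a, atom a & a <= x.

(* "Non-atomic" is read literally as "not atomic". Every atomless algebra
   with more than one element is non-atomic in this sense. *)
Definition nonatomic : Prop := ~ atomic.

Definition sigma_finite_cc : Prop :=
  exists S : nat -> set B,
    [set x : B | x != \bot] = \bigcup_n S n /\
    (forall n (A : set B), A `<=` S n -> antichain A -> finite_set A).

Definition Part : Type := {A : set B | maximal_antichain A}.

Definition Part_star : relsys :=
  @RelSys Part Part (fun A P => almost_refines (sval A) (sval P)).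

End BooleanAlgebraProperties.

(* Main.v *)
Require Import Defs.
From mathcomp Require Import all_boot all_order.
From mathcomp Require Import finmap boolp classical_sets functions cardinality.

(** Below an element without atoms there is a disjoint sequence [e 0], [e 1], ...
of nonzero elements.  The pieces of the [sigma_finite_cc] decomposition may be
replaced by increasing, upward closed sets [T k] without infinite antichains;
the complement of [T k] is then downward closed, and dense below the [e n].
Send [f] to a maximal antichain [A] which, below [e n], consists of elements
outside [T (f n)], and send a partition [P] to a function [g] such that
[T (g n)] contains an element of [P] meeting [e n].  If [P] almost refines
[A], then for all but finitely many [n] the elements of [P] meeting [e n] lie
below members of [A] below [e n], hence outside [T (f n)], so [f n < g n]. *)

Set Implicit Arguments.
Unset Strict Implicit.
Unset Printing Implicit Defensive.

Import Order.Theory.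
Local Open Scope order_scope.
Local Open Scope classical_set_scope.

Section Antichains.
Context {d : Order.disp_t} {B : ctbDistrLatticeType d}.
Implicit Types (x y z : B) (A D P : set B).

(** * Elements without atoms and disjoint sequences *)

Definition atomless_below x : Prop := forall a, atom a -> ~ a <= x.

Definition disjoint_seq (e : nat -> B) : Prop :=
  (forall n, e n != \bot) /\
  (forall m n, m != n -> Order.meet (e m) (e n) = \bot).

Lemma nonatomic_atomless_below :
  nonatomic B -> exists2 x : B, x != \bot & atomless_below x.
Proof.
move=> natB; apply: contrapT => noX; apply: natB => x x0.
apply: contrapT => noa; apply: noX; exists x => // a ata ax.
by apply: noa; exists a.
Qed.

Lemma atomless_belowW x y : y <= x -> atomless_below x -> atomless_below y.
Proof. by move=> yx ax a /ax nax /le_trans /(_ yx). Qed.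

Lemma meet_neq0W x y z : y <= z ->
  Order.meet x y != \bot -> Order.meet x z != \bot.
Proof.
by move=> yz; apply: contraNneq => xz0; rewrite -lex0 -xz0 leI2.
Qed.

(** With no nonzero element strictly below it, [x] would itself be an atom. *)
Lemma atomless_below_split x : x != \bot -> atomless_below x ->
  exists y, [/\ y != \bot & y < x].
Proof.
move=> x0 atx; apply: contrapT => noy; apply: (atx x) => //; split=> // y yx.
have [->|y0] := eqVneq y \bot; first by left.
by right; apply: contrapT => /eqP yx'; apply: noy; exists y; rewrite lt_neqAle yx'.
Qed.

(** Repeated splitting yields a strictly decreasing sequence [u] starting at [x]; its successive
    differences are nonzero and pairwise disjoint. *)
Lemma atomless_below_disjoint_seq x : x != \bot -> atomless_below x ->
  exists2 e, disjoint_seq e & forall n, e n <= x.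
Proof.
move=> x0 atx.
(* The splitting is made total, with [\bot] as default value, so that it can be iterated. *)
have /choice[s sP] : forall y, exists z, y != \bot -> y <= x ->
    z != \bot /\ z < y.
  move=> y; have [[y0 yx]|ny] := pselect (y != \bot /\ y <= x).
    have [z [z0 zy]] := atomless_below_split y0 (atomless_belowW yx atx).
    by exists z.
  by exists \bot => y0 yx; case: ny.
pose u n := iter n s x.
have uP n : u n != \bot /\ u n <= x.
  elim: n => [|n [un0 unx]]; first by split.
  have [v0 vu] := sP _ un0 unx; split=> //.
  exact: le_trans (ltW vu) unx.
have ult n : u n.+1 < u n by have [un0 unx] := uP n; case: (sP _ un0 unx).
have ule m n : (m <= n)%N -> u n <= u m.
  move=> /subnK <-; elim: (n - m)%N => // k.
  exact: le_trans (ltW (ult _)).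
pose e n := Order.diff (u n) (u n.+1).
have eu n : e n <= u n by exact: leBx.
(* For [m < n], [e n] lies below [u m.+1], which was removed from [e m]. *)
have disj m n : (m < n)%N -> Order.meet (e m) (e n) = \bot.
  move=> mn; apply/eqP; rewrite -lex0.
  have <- : Order.meet (e m) (u m.+1) = \bot by rewrite diffIK.
  by apply: leI2 => //; exact: le_trans (eu n) (ule _ _ mn).
exists e => [|n]; last by apply: le_trans (eu n) _; case: (uP n).
split=> [n|m n mn].
  by apply/negP; rewrite diff_eq0 lt_geF.
case: (ltngtP m n) mn => // [mn|nm] _; first exact: disj.
by rewrite meetC disj.
Qed.

Lemma disjoint_seq_range_antichain e : disjoint_seq e -> antichain (range e).
Proof.
move=> [e0 ed]; split=> [_ [n _ <-] //|_ _ [m _ <-] [n _ <-] mn].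
by apply: ed; apply: contra mn => /eqP ->.
Qed.

Lemma disjoint_seq_range_infinite e : disjoint_seq e -> infinite_set (range e).
Proof.
move=> [e0 ed] fe; apply: infinite_nat.
suff inje : set_inj setT e by move: fe; rewrite (eq_finite_set (inj_card_eq inje)).
move=> m n _ _ emn; apply/eqP; apply: contraT => /ed.
by rewrite emn meetxx => /eqP; rewrite (negbTE (e0 n)).
Qed.

(** * Maximal antichains and density *)

Definition dense_set D : Prop :=
  forall y, y != \bot -> exists z, [/\ D z, z != \bot & z <= y].

(** If [y] were disjoint from all of [A], maximality would put [y] into [A], yet [y] meets
    itself. *)
Lemma maximal_antichain_meet A y : maximal_antichain A -> y != \bot ->
  exists2 a, A a & Order.meet a y != \bot.
Proof.
move=> [[A0 Ad] Amax] y0; apply: contrapT => noa.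
have dy a : A a -> Order.meet a y = \bot.
  by move=> Aa; apply/eqP; apply: contraT => ay; case: noa; exists a.
have Ay : A y.
  rewrite -(Amax (A `|` [set y])); [by right| |by left].
  split=> [a [/A0 //|-> //]|a b [Aa|->] [Ab|->]].
  - exact: Ad.
  - by rewrite dy.
  - by rewrite meetC dy.
  - by rewrite eqxx.
by apply: noa; exists y; rewrite ?meetxx.
Qed.

(** Zorn's lemma gives an antichain [A] maximal among those inside [D]. It is maximal among all
    antichains: below a new element [y] of a larger one, density finds a [z] in [D] that could be
    added to [A]. *)
Lemma dense_set_maximal_antichain D : dense_set D ->
  exists2 A, maximal_antichain A & A `<=` D.
Proof.
move=> Dd.
have [|A [[Aanti AD] Amax]] := @Zorn_bigcup B
    [set A | antichain A /\ A `<=` D].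
  move=> C CP Ctot; split; last by move=> a [X /CP[_ XD] /XD].
  split=> [a [X /CP[[X0 _] _] /X0 //]|a b [X CX Xa] [Y CY Yb]].
  have [XY|YX] := Ctot _ _ CX CY.
    by have [[_ Yd] _] := CP _ CY; apply: Yd => //; exact: XY.
  by have [[_ Xd] _] := CP _ CX; apply: Xd => //; exact: YX.
exists A => //; split=> // A' [A'0 A'd] AA'; apply/seteqP; split=> // y A'y.
apply: contrapT => nAy.
have [z [Dz z0 zy]] := Dd _ (A'0 _ A'y).
have dz a : A a -> Order.meet a z = \bot.
  move=> Aa; apply/eqP; rewrite -lex0 -(A'd a y (AA' _ Aa) A'y) ?leI2//.
  by apply: contra_notN nAy => /eqP <-.
have [A0 Ad] := Aanti.
have nAz : ~ A z by move=> /dz; rewrite meetxx; exact/eqP.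
apply: (Amax (A `|` [set z])).
  by split; [left|move=> /(_ z (or_intror erefl))].
split; last by move=> a [/AD //|->].
split=> [a [/A0 //|-> //]|a b [Aa|->] [Ab|->]].
- exact: Ad.
- by rewrite dz.
- by rewrite meetC dz.
- by rewrite eqxx.
Qed.

(** * Sets without infinite antichains *)

Definition finite_cc S : Prop :=
  forall A, A `<=` S -> antichain A -> finite_set A.

Lemma finite_ccU S S' : finite_cc S -> finite_cc S' -> finite_cc (S `|` S').
Proof.
move=> fS fS' A AS [A0 Ad].
have -> : A = (A `&` S) `|` (A `&` S').
  by rewrite -setIUr; apply/esym/setIidPl.
rewrite finite_setU; split; [apply: fS|apply: fS'] => [x []//| | x []//|];
  by split=> [a []/A0//|a b [Aa _] [Ab _]]; exact: Ad.
Qed.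

Definition up_closure S : set B := [set y | exists2 s, S s & s <= y].

(** Choosing a member of [S] below each element of an antichain gives an antichain in [S]. The
    choice is injective, because disjoint nonzero elements are distinct. *)
Lemma finite_cc_up_closure S : S `<=` [set x | x != \bot] ->
  finite_cc S -> finite_cc (up_closure S).
Proof.
move=> S0 fS A AS [A0 Ad].
have /choice[s sP] : forall y, exists z, A y -> S z /\ z <= y.
  move=> y; have [/AS[z Sz zy]|nAy] := pselect (A y); first by exists z.
  by exists \bot.
have sd a b : A a -> A b -> a != b -> Order.meet (s a) (s b) = \bot.
  move=> Aa Ab ab; apply/eqP; rewrite -lex0 -(Ad a b)// leI2//.
    by case: (sP a).
  by case: (sP b).
have : finite_set (s @` A).
  apply: fS => [_ [a /sP[Sa _] <-] //|].
  split=> [_ [a /sP[/S0 Sa _] <-] //|_ _ [a Aa <-] [b Ab <-] ab].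
  by apply: sd => //; apply: contra ab => /eqP ->.
suff sinj : set_inj A s by rewrite (eq_finite_set (inj_card_eq sinj)).
move=> a b; rewrite !inE => Aa Ab sab.
apply/eqP; apply: contraT => /(sd _ _ Aa Ab); rewrite sab meetxx => sb0.
by have [/S0/=] := sP b Ab; rewrite sb0 eqxx.
Qed.

(** [T k] is the upward closure of the union of [S 0], ..., [S k]; finite unions and upward closure
    both preserve the finiteness of antichains. *)
Lemma sigma_finite_cc_monotone : sigma_finite_cc B ->
  exists T : nat -> set B,
    [/\ forall x, x != \bot -> exists k, T k x,
        forall j k, (j <= k)%N -> T j `<=` T k,
        forall k x y, x <= y -> T k x -> T k y &
        forall k, finite_cc (T k)].
Proof.
move=> [S [SE fS]].
pose V k := \bigcup_(j in [set j | (j <= k)%N]) S j.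
have V0 k : V k `<=` [set x | x != \bot].
  by rewrite SE => x [j _ Sx]; exists j.
have fV k : finite_cc (V k).
  elim: k => [|k IHk].
    have -> : V 0%N = S 0%N; last exact: fS.
    apply/seteqP; split=> [x [j]|x Sx]; last by exists 0%N.
    by rewrite /= leqn0 => /eqP ->.
  have -> : V k.+1 = V k `|` S k.+1; last exact: finite_ccU (fS _).
  apply/seteqP; split=> [x [j]|x [[j /= jk Sx]|Sx]].
  - rewrite /= leq_eqVlt => /orP[/eqP ->|jk] Sx; first by right.
    by left; exists j.
  - by exists j => //=; rewrite ltnW.
  - by exists k.+1 => /=.
exists (fun k => up_closure (V k)); split.
- move=> x x0; have : [set x : B | x != \bot] x by [].
  by rewrite SE => -[k _ Sx]; exists k, x => //; exists k => /=.
- move=> j k jk x [s [i /= ij Ss] sx]; exists s => //.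
  by exists i => //=; exact: leq_trans jk.
- by move=> k x y xy [s Vs sx]; exists s => //; exact: le_trans xy.
- by move=> k; exact: finite_cc_up_closure.
Qed.

(** Otherwise [T] would contain an infinite disjoint sequence below [x]. *)
Lemma finite_cc_avoid T x : finite_cc T -> atomless_below x -> x != \bot ->
  exists z, [/\ ~ T z, z != \bot & z <= x].
Proof.
move=> fT atx x0; have [e ed ex] := atomless_below_disjoint_seq x0 atx.
apply: contrapT => noz; apply: (disjoint_seq_range_infinite ed).
apply: fT; last exact: disjoint_seq_range_antichain.
move=> _ [n _ <-]; apply: contrapT => nT; apply: noz; exists (e n).
by split=> //; case: ed.
Qed.

(** * The Galois-Tukey connection *)

Section Tukey.
Variables (e : nat -> B) (T : nat -> set B).
Hypotheses (ed : disjoint_seq e) (e_atomless : forall n, atomless_below (e n)).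
Hypotheses (Tcover : forall x, x != \bot -> exists k, T k x)
  (Tmono : forall j k, (j <= k)%N -> T j `<=` T k)
  (Tup : forall k x y, x <= y -> T k x -> T k y)
  (Tfin : forall k, finite_cc (T k)).

(** Some nonzero elements may be disjoint from every [e n]; the second alternative admits them, for
    the sake of density. *)
Definition avoiding (f : nat -> nat) : set B :=
  [set y | (exists2 n, y <= e n & ~ T (f n) y) \/
           (forall n, Order.meet y (e n) = \bot)].

Lemma avoiding_dense f : dense_set (avoiding f).
Proof.
move=> y y0.
have [[n yn0]|noy] := pselect (exists n, Order.meet y (e n) != \bot); last first.
  exists y; split=> //; right=> n; apply/eqP; apply: contraT => yn.
  by case: noy; exists n.
have [|z [nTz z0]] := finite_cc_avoid (@Tfin (f n)) _ yn0.
  apply: (atomless_belowW _ (@e_atomless n)); exact: leIr.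
by rewrite lexI => /andP[zy zn]; exists z; split=> //; left; exists n.
Qed.

Lemma avoiding_meet f y n : avoiding f y -> Order.meet y (e n) != \bot ->
  y <= e n /\ ~ T (f n) y.
Proof.
move=> [[m ym nTy]|yd] yn; last by rewrite yd eqxx in yn.
have [<-//|mn] := eqVneq m n.
have : Order.meet y (e n) <= Order.meet (e m) (e n) by rewrite leI2.
by case: ed => _ ->//; rewrite lex0 (negbTE yn).
Qed.

(** An element of [avoiding f] that meets some [e n] lies below it, hence meets no other term of the
    sequence. *)
Lemma avoiding_finite_meet f (F : {fset B}) : [set` F] `<=` avoiding f ->
  finite_set [set n | exists2 a, a \in F & Order.meet a (e n) != \bot].
Proof.
move=> Ff.
have -> : [set n | exists2 a, a \in F & Order.meet a (e n) != \bot] =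
    \bigcup_(a in [set` F]) [set n | Order.meet a (e n) != \bot].
  by apply/seteqP; split=> n [a]; exists a.
apply: bigcup_finite => // a Fa.
have [[m am]|noa] := pselect (exists m, Order.meet a (e m) != \bot); last first.
  apply: (sub_finite_set _ (finite_set0 _)) => n an.
  by apply: noa; exists n.
apply: (sub_finite_set _ (finite_set1 m)) => n /= an.
have [aem _] := avoiding_meet (Ff _ Fa) am.
apply/eqP; apply: contraT; rewrite eq_sym => mn.
have : Order.meet a (e n) <= Order.meet (e m) (e n) by rewrite leI2.
by case: ed => _ ->//; rewrite lex0 (negbTE an).
Qed.

Lemma almost_refines_avoiding f g A P :
  A `<=` avoiding f -> almost_refines A P ->
  (forall n, exists p, [/\ P p, T (g n) p & Order.meet p (e n) != \bot]) ->
  le_star f g.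
Proof.
move=> Af [F FA AP] gP.
(* The exceptional [n] are those for which [e n] meets a member of the collapsed set [F]. *)
have := @avoiding_finite_meet f F (subset_trans FA Af).
apply: sub_finite_set => n /= nfg; apply: contrapT => noF.
have [p [Pp Tp pn]] := gP n.
have [a aAF pa] := AP _ Pp.
have an : Order.meet a (e n) != \bot.
  by rewrite meetC; apply: meet_neq0W pa _; rewrite meetC.
case: aAF => [[Aa _]|aF].
  have [_ nTa] := avoiding_meet (Af _ Aa) an.
  (* If [g n < f n], then [T (g n) p] and [p <= a] put [a] into [T (f n)], a contradiction. *)
  apply: nTa; apply: Tmono (Tup pa Tp).
  by move/negP: nfg; rewrite -ltnNge => /ltnW.
(* Here [a] is the join of [F]; for a non-exceptional [n] every member of [F], hence the join, is
   disjoint from [e n]. *)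
move: an; rewrite aF => /negP; apply.
rewrite disj_leC; apply/joinsP_seq => b bF _.
by rewrite -disj_leC; apply: contraT => bn; case: noF; exists b.
Qed.

Lemma omega_star_Tukey_le_Part_star : Tukey_le omega_star (Part_star B).
Proof.
have /choice[phim phimP] : forall f : nat -> nat,
    exists A : Part B, sval A `<=` avoiding f.
  move=> f; have [A Amax Af] := dense_set_maximal_antichain (@avoiding_dense f).
  by exists (exist _ A Amax).
have /choice[phip phipP] : forall P : Part B, exists g : nat -> nat,
    forall n, exists p, [/\ sval P p, T (g n) p & Order.meet p (e n) != \bot].
  move=> [P Pmax].
  suff /choice[g gP] : forall n, exists k, exists p,
      [/\ P p, T k p & Order.meet p (e n) != \bot] by exists g.
  move=> n.
  have [p Pp pn] := maximal_antichain_meet Pmax (ed.1 n).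
  have [k Tk] := Tcover (Pmax.1.1 p Pp).
  by exists k, p.
exists phim, phip => f P fP.
exact: almost_refines_avoiding (phimP f) fP (phipP P).
Qed.

End Tukey.
End Antichains.

Theorem theorem3p11 (d : Order.disp_t) (B : ctbDistrLatticeType d) :
  nonatomic B -> sigma_finite_cc B -> Tukey_le omega_star (Part_star B).
Proof.
move=> /nonatomic_atomless_below[x x0 atx].
move=> /sigma_finite_cc_monotone[T [Tcover Tmono Tup Tfin]].
have [e ed ex] := atomless_below_disjoint_seq x0 atx.
apply: (omega_star_Tukey_le_Part_star ed _ Tcover Tmono Tup Tfin) => n.
exact: atomless_belowW (ex n) atx.
Qed.
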